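(* Assume (A1), (A2), (A3) (see context) and let $\zeta\ge 0$. Then $$\mathbb E_0\Big[\sum_{x\in\xi:\,x\sim 0}|x|^\zeta\Big]<+\infty$$ (here $x\sim 0$ refers to adjacency in $\mathrm{DT}(\xi)$) provided at least one of the following holds: (H1) $\rho_\gamma<+\infty$ for some $\gamma>2$, and Condition $C(\alpha)$ holds for some $\alpha>\frac{\gamma}{\gamma-2}(d+\zeta)$; (H2) $\rho_2<+\infty$ and $\mathbb P$ has finite range of dependence; (H3) $\rho_2<+\infty$, $\mathbb P$ has positive association, and Condition $C(\alpha)$ holds for some $\alpha>d+\zeta$.
   Context: Notation: $|\cdot|$ is the Euclidean norm on $\mathbb R^d$, $\Lambda_r=[-r,r]^d$. $\mathcal N$ is the set of locally finite subsets of $\mathbb R^d$; $\xi\in\mathcal N$ is identified with the counting measure $\sum_{x\in\xi}\delta_x$, so $\xi(A)=\#(\xi\cap A)$; $\mathcal N$ carries the $\sigma$-algebra generated by the maps $\xi\mapsto\xi(A)$, $A$ Borel. Translations: $\tau_x\xi:=\xi-x$. For $\xi\in\mathcal N$, $x\in\xi$, the Voronoi cell is $\mathrm{Vor}(x|\xi)=\{y\in\mathbb R^d:|y-x|\le|y-z|\ \forall z\in\xi\}$. The Delaunay triangulation $\mathrm{DT}(\xi)$ is the graph with vertex set $\xi$ and edges the pairs $\{x,y\}$, $x\neq y$ in $\xi$, such that $\mathrm{Vor}(x|\xi)$ and $\mathrm{Vor}(y|\xi)$ share a $(d-1)$-dimensional face; write $x\sim y$. Setting: $(\Omega,\mathcal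 F,\mathcal P)$ is a probability space with a measurable action $(\theta_x)_{x\in\mathbb R^d}$ of $\mathbb R^d$ ($\theta_0=\mathrm{id}$, $\theta_x\circ\theta_y=\theta_{x+y}$, $(x,\omega)\mapsto\theta_x\omega$ measurable); $\omega\mapsto\hat\omega\in\mathcal N$ is a simple point process on it with law $\mathbb P$ (expectation $\mathbb E$); $(\omega,x,y)\mapsto c_{x,y}(\omega)\in[0,\infty)$ is a measurable symmetric conductance field, with $c_{x,x}=0$ and $c_{x,y}(\omega)=0$ if $\{x,y\}$ is not an edge of $\mathrm{DT}(\hat\omega)$. Assumptions: (A1) $\mathcal P(\theta_xA)=\mathcal P(A)$ for all $x,A$, and $\mathcal P(\hat\omega=\emptyset)=0$; (A2) the intensity $m:=\mathbb E[\xi([0,1]^d)]$ lies in $(0,\infty)$; (A3) there is a measurable $\Omega_*$ with $\theta_x\Omega_*=\Omega_*$ for all $x$ and $\mathcal P(\Omega_* )=1$ such that for every $\omega\in\Omega_*$: $\widehat{\theta_x\omega}=\tau_x\hat\omega$ for all $x$, and $c_{y-x,z-x}(\theta_x\omega)=c_{y,z}(\omega)$ for all $x$ and all edges $\{y,z\}$ of $\mathrm{DT}(\hat\omega)$. The Palm distribution $\mathbb P_0$ of $\mathbb P$ is the probability on $\mathcal N$ given by $\mathbb P_0(A)=\frac1m\int d\mathbb P(\xi)\sum_{x\in\xi\cap[0,1]^d}\mathbf 1_A(\tau_x\xi)$; it is concentrated on $\{\xi:0\in\xi\}$; $\mathbb E_0$ is its expectation. $\rho_\gamma:=\mathbb E[\xi([0,1]^d)^\gamma]$.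 Condition $C(\alpha)$ ($\alpha>0$): there is $\kappa>0$ with $\mathbb P(\xi(\Lambda_\ell)=0)\le\kappa\ell^{-\alpha}$ for all $\ell\ge1$. $\mathbb P$ has finite range of dependence if there is $L>0$ such that for all Borel $A,B\subset\mathbb R^d$ at Euclidean distance at least $L$, the random sets $\xi\cap A$ and $\xi\cap B$ are independent under $\mathbb P$. $\mathbb P$ has positive association if for all $n,k\ge0$, all weakly increasing $f:\mathbb R_+^n\to\mathbb R$, $g:\mathbb R_+^k\to\mathbb R$ and all pairwise disjoint bounded Borel sets $A_1,\dots,A_n,B_1,\dots,B_k$, $\mathrm{Cov}(f(\xi(A_1),\dots,\xi(A_n)),g(\xi(B_1),\dots,\xi(B_k)))\ge0$ whenever both variables have finite second moment under $\mathbb P$. *)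

(* Defs.v *)
From HB Require Import structures.
From mathcomp Require Import all_boot all_order all_algebra.
From mathcomp Require Import all_classical all_reals all_analysis.
From mathcomp Require Import measurable_realfun.
Set Implicit Arguments. Unset Strict Implicit. Unset Printing Implicit Defensive.
Import Order.TTheory GRing.Theory Num.Theory.
Import numFieldNormedType.Exports.
Local Open Scope classical_set_scope.
Local Open Scope ring_scope.

Definition vec (R : realType) (d : nat) := 'rV[R]_d.

Definition borel_vec (R : realType) (d : nat) : set (set (vec R d)) :=
  <<s [set A : set (vec R d) | open A] >>.

Definition prod_sigma (X Y : Type) (SX : set (set X)) (SY : set (set Y))
  : set (set (X * Y)) :=
  <<s [set S | exists A B, SX A /\ SY B /\ S = A `*` B] >>.

Definition enorm (R : realType) (d : nat) (x : vec R d) : R :=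
  Num.sqrt (\sum_(i < d) x ord0 i ^+ 2).

Definition Lam (R : realType) (d : nat) (r : R) : set (vec R d) :=
  [set x | forall i, `|x ord0 i| <= r].
Definition unit_cube (R : realType) (d : nat) : set (vec R d) :=
  [set x | forall i, 0 <= x ord0 i <= 1].
Arguments Lam {R} d r.
Arguments unit_cube {R} d.

Definition bounded_vec (R : realType) (d : nat) (A : set (vec R d)) : Prop :=
  exists r : R, A `<=` Lam d r.

Definition ncount (R : realType) (d : nat) (xi A : set (vec R d)) : \bar R :=
  counting (xi `&` A).

Definition locally_finite (R : realType) (d : nat) (xi : set (vec R d)) : Prop :=
  forall r : R, finite_set (xi `&` Lam d r).

Definition translate (R : realType) (d : nat) (x : vec R d) (xi : set (vec R d))
  : set (vec R d) := [set y - x | y in xi].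

Definition vor (R : realType) (d : nat) (xi : set (vec R d)) (x : vec R d)
  : set (vec R d) :=
  [set y | forall z, xi z -> enorm (y - x) <= enorm (y - z)].

(** [aff_dim_ge S k]: S contains k+1 affinely independent points, i.e. the
    affine hull of S has dimension >= k. *)
Definition aff_dim_ge (R : realType) (d : nat) (S : set (vec R d)) (k : nat)
  : Prop :=
  exists (q : vec R d) (p : 'I_k -> vec R d), S q /\ (forall i, S (p i)) /\
    row_free (\matrix_(i < k) (p i - q)).

(** Delaunay adjacency x ~ y in DT(xi): the Voronoi cells of x and y share a
    (d-1)-dimensional face, i.e. their intersection (which is their common
    face) has affine dimension exactly d-1. *)
Definition dt_adj (R : realType) (d : nat) (xi : set (vec R d)) (x y : vec R d)
  : Prop :=
  xi x /\ xi y /\ x <> y /\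
  aff_dim_ge (vor xi x `&` vor xi y) d.-1 /\
  ~ aff_dim_ge (vor xi x `&` vor xi y) d.

(** Quantities attached to the law P of the point process w |-> hat w
    (P is the image of Pr under hat, so E[f(xi)] = \int[Pr]_w f (hat w)). *)

Definition intensity (R : realType) (d : nat) (d0 : measure_display)
  (Omega : measurableType d0) (Pr : probability Omega R)
  (hat : Omega -> set (vec R d)) : \bar R :=
  (\int[Pr]_w ncount (hat w) (unit_cube d))%E.

Definition rho (R : realType) (d : nat) (d0 : measure_display)
  (Omega : measurableType d0) (Pr : probability Omega R)
  (hat : Omega -> set (vec R d)) (g : R) : \bar R :=
  (\int[Pr]_w poweR (ncount (hat w) (unit_cube d)) g)%E.

Definition condC (R : realType) (d : nat) (d0 : measure_display)
  (Omega : measurableType d0) (Pr : probability Omega R)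
  (hat : Omega -> set (vec R d)) (alpha : R) : Prop :=
  exists kappa : R, 0 < kappa /\
    forall l : R, 1 <= l ->
      (Pr [set w | ncount (hat w) (Lam d l) = 0%E] <= (kappa * l `^ (- alpha))%:E)%E.

Definition sigma_restr (R : realType) (d : nat) (d0 : measure_display)
  (Omega : measurableType d0) (hat : Omega -> set (vec R d)) (A : set (vec R d))
  : set (set Omega) :=
  <<s [set E | exists (C : set (vec R d)) (U : set (\bar R)),
         borel_vec C /\ measurable U /\
         E = [set w | U (ncount (hat w `&` A) C)]] >>.

Definition finite_range (R : realType) (d : nat) (d0 : measure_display)
  (Omega : measurableType d0) (Pr : probability Omega R)
  (hat : Omega -> set (vec R d)) : Prop :=
  exists L : R, 0 < L /\
    forall A B : set (vec R d), borel_vec A -> borel_vec B ->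
      (forall a b, A a -> B b -> L <= enorm (a - b)) ->
      forall E1 E2, sigma_restr hat A E1 -> sigma_restr hat B E2 ->
        Pr (E1 `&` E2) = (Pr E1 * Pr E2)%E.

Definition pos_assoc (R : realType) (d : nat) (d0 : measure_display)
  (Omega : measurableType d0) (Pr : probability Omega R)
  (hat : Omega -> set (vec R d)) : Prop :=
  forall (n k : nat) (f : ('I_n -> R) -> R) (g : ('I_k -> R) -> R)
         (A : 'I_n -> set (vec R d)) (B : 'I_k -> set (vec R d)),
    (forall u v, (forall i, 0 <= u i <= v i) -> f u <= f v) ->
    (forall u v, (forall i, 0 <= u i <= v i) -> g u <= g v) ->
    (forall i, borel_vec (A i) /\ bounded_vec (A i)) ->
    (forall j, borel_vec (B j) /\ bounded_vec (B j)) ->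
    (forall i i', i <> i' -> A i `&` A i' = set0) ->
    (forall j j', j <> j' -> B j `&` B j' = set0) ->
    (forall i j, A i `&` B j = set0) ->
    let X := fun w => f (fun i => fine (ncount (hat w) (A i))) in
    let Y := fun w => g (fun j => fine (ncount (hat w) (B j))) in
    Pr.-integrable setT (fun w => (X w ^+ 2)%:E) ->
    Pr.-integrable setT (fun w => (Y w ^+ 2)%:E) ->
    (0 <= covariance Pr X Y)%E.

Definition palm_E (R : realType) (d : nat) (d0 : measure_display)
  (Omega : measurableType d0) (Pr : probability Omega R)
  (hat : Omega -> set (vec R d)) (F : set (vec R d) -> \bar R) : \bar R :=
  ((fine (intensity Pr hat))^-1%:E *
   \int[Pr]_w (\esum_(x in hat w `&` unit_cube d) F (translate x (hat w))))%E.

Definition nbr_moment (R : realType) (d : nat) (zeta : R) (xi : set (vec R d))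
  : \bar R :=
  \esum_(z in [set z | dt_adj xi z 0]) ((enorm z) `^ zeta)%:E.

(* Main.v *)
Require Import Defs.
From HB Require Import structures.
From mathcomp Require Import all_boot all_order all_algebra.
From mathcomp Require Import all_classical all_reals all_analysis.
From mathcomp Require Import measurable_realfun.
From mathcomp Require Import finmap ring lra zify.
Import Order.TTheory GRing.Theory Num.Theory.
Import numFieldNormedType.Exports.
Local Open Scope classical_set_scope.
Local Open Scope ring_scope.

(* If [z] is a Delaunay neighbour of [x] with [|z - x| >= r], then a ball of
   radius [r / 2] with [x] on its boundary contains no point of the configuration
   (any common point of the two Voronoi cells is the centre of a larger empty
   ball).  So one of boundedly many grid boxes of side comparable to [r], all far
   from [x] and from [z], is empty.  Summing over shells [|z - x| ~ 3 ^ n] and over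
   unit cells [C], the Palm expectation is bounded by a sum of terms
   [3 ^ (n zeta) * E[xi(U) xi(C) 1_void] <= 3 ^ (n zeta) *
   (E[xi(U)^2 1_void] + E[xi(C)^2 1_void])] over [O(3 ^ (n d))] cells.  It remains
   that these second moments decay faster than [3 ^ (- n (d + zeta))]: by Hoelder
   under (H1), and because the void probability factors out under (H2) and (H3).
   Under (H2), [p (3 l) <= p l ^ 2] for the void probability [p l] of [Lam l], hence
   [p] decays faster than any power. *)

Set Implicit Arguments.
Unset Strict Implicit.
Unset Printing Implicit Defensive.

(** * Euclidean geometry: empty balls and separated empty boxes *)

Section geometry.
Context {R : realType} {d : nat}.
Implicit Types x y z p c : vec R d.

Definition dot x y : R := \sum_(i < d) x ord0 i * y ord0 i.

Lemma enorm_ge0 x : 0 <= enorm x.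
Proof. exact: sqrtr_ge0. Qed.

Lemma enorm_sqr x : enorm x ^+ 2 = dot x x.
Proof. by rewrite sqr_sqrtr// sumr_ge0// => i _; rewrite sqr_ge0. Qed.

Lemma enorm_le x y : (enorm x <= enorm y) = (dot x x <= dot y y).
Proof. by rewrite -!enorm_sqr ler_sqr ?nnegrE ?enorm_ge0. Qed.

Lemma dotC x y : dot x y = dot y x.
Proof. by apply: eq_bigr => i _; rewrite mulrC. Qed.

Lemma dotDl x y z : dot (x + y) z = dot x z + dot y z.
Proof. by rewrite -big_split/=; apply: eq_bigr => i _; rewrite mxE mulrDl. Qed.

Lemma dotNl x z : dot (- x) z = - dot x z.
Proof. by rewrite /dot -sumrN; apply: eq_bigr => i _; rewrite mxE mulNr. Qed.

Lemma dotZl (a : R) x z : dot (a *: x) z = a * dot x z.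
Proof. by rewrite mulr_sumr; apply: eq_bigr => i _; rewrite mxE mulrA. Qed.

Lemma dotDr x y z : dot z (x + y) = dot z x + dot z y.
Proof. by rewrite dotC dotDl !(dotC z). Qed.

Lemma dotNr x z : dot z (- x) = - dot z x.
Proof. by rewrite dotC dotNl dotC. Qed.

Lemma dotZr (a : R) x z : dot z (a *: x) = a * dot z x.
Proof. by rewrite dotC dotZl dotC. Qed.

Definition dotE := (dotDl, dotNl, dotZl, dotDr, dotNr, dotZr).

Lemma dot_ge0 x : 0 <= dot x x.
Proof. by rewrite -enorm_sqr sqr_ge0. Qed.

Lemma dot_eq0 x : dot x x = 0 -> x = 0.
Proof.
move=> /eqP; rewrite psumr_eq0; last by move=> i _; rewrite -expr2 sqr_ge0.
move=> /allP x0; apply/rowP => i; rewrite mxE; apply/eqP.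
by have := x0 i (mem_index_enum i); rewrite mulf_eq0 orbb.
Qed.

Lemma cauchy_schwarz x y : dot x y <= enorm x * enorm y.
Proof.
have h : dot x x * dot x y ^+ 2 <= dot x x * (dot x x * dot y y).
  have := dot_ge0 (dot x x *: y - dot x y *: x).
  by rewrite !dotE (dotC y x); nra.
have [x0|x0] := eqVneq (dot x x) 0.
  by rewrite (dot_eq0 x0) /dot big1 ?mulr_ge0 ?enorm_ge0// => i _; rewrite mxE mul0r.
have {}h : dot x y ^+ 2 <= (enorm x * enorm y) ^+ 2.
  by rewrite exprMn !enorm_sqr -(ler_pM2l (x := dot x x))// lt_neqAle eq_sym x0 dot_ge0.
have [/le_trans->//|xy0] := leP (dot x y) 0; first by rewrite mulr_ge0 ?enorm_ge0.
by rewrite -ler_sqr// nnegrE ?mulr_ge0 ?enorm_ge0 // ltW.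
Qed.

Lemma enormD x y : enorm (x + y) <= enorm x + enorm y.
Proof.
rewrite -ler_sqr ?nnegrE ?addr_ge0 ?enorm_ge0// enorm_sqr !dotE.
rewrite (dotC y x) sqrrD !enorm_sqr.
by have := cauchy_schwarz x y; lra.
Qed.

Lemma normr_coord_le x i : `|x ord0 i| <= enorm x.
Proof.
rewrite -ler_sqr ?nnegrE ?enorm_ge0// real_normK ?num_real// enorm_sqr.
rewrite /dot (bigD1 i)//= -expr2 lerDl sumr_ge0// => j _.
by rewrite -expr2 sqr_ge0.
Qed.

(** The cruder constant [d] in place of its square root, from [d <= d ^ 2], keeps the later
    geometric constants integral. *)
Lemma enorm_le_coord x (M : R) : 0 <= M ->
  (forall i, `|x ord0 i| <= M) -> enorm x <= d%:R * M.
Proof.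
move=> M0 xM; rewrite -ler_sqr ?nnegrE ?enorm_ge0 ?mulr_ge0// enorm_sqr.
apply: (@le_trans _ _ (\sum_(i < d) M ^+ 2)).
  apply: ler_sum => i _; rewrite -expr2 -(real_normK (num_real (x ord0 i))).
  by rewrite ler_sqr ?nnegrE// (le_trans _ (xM i)).
rewrite sumr_const card_ord -[leLHS]mulr_natl exprMn ler_wpM2r ?sqr_ge0//.
by rewrite -natrX ler_nat; case: (d) => // n; rewrite leq_pmulr.
Qed.

(* The ball centred at a common point of two cells with the two nuclei on its
   boundary contains no point of the configuration; shrinking it towards [0]
   gives an empty ball of prescribed radius still touching [0]. *)
Lemma empty_ball (eta : set (vec R d)) z r : dt_adj eta z 0 ->
  0 < r -> r <= enorm z ->
  exists c, enorm c = r / 2 /\ forall y, eta y -> r / 2 <= enorm (y - c).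
Proof.
(* Here [p] is a point of both Voronoi cells, taken from the common face. *)
move=> [etaz [eta0 [_ [[p [_ [[pz p0] _]]] _]]]] r0 rz.
(* Every [y] of [eta] lies outside the open ball of centre [p] and radius [|p|]; next, [z] lies on
   its sphere. *)
have empty y : eta y -> 2 * dot y p <= dot y y.
  by move=> /p0; rewrite subr0 enorm_le !dotE (dotC p y); lra.
have zp : dot z z = 2 * dot z p.
  apply/le_anti; rewrite empty// andbT.
  by have := pz _ eta0; rewrite subr0 enorm_le !dotE (dotC p z); lra.
(* Since [0] and [z] lie on a sphere around [p], [|z| <= 2 |p|]; algebraically this is
   [|z - 2 p| ^ 2 >= 0]. *)
have rp : r / 2 <= enorm p.
  rewrite -ler_sqr ?nnegrE ?enorm_ge0 ?divr_ge0 ?(ltW r0)// enorm_sqr.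
  have : r ^+ 2 <= enorm z ^+ 2 by rewrite ler_sqr ?nnegrE ?enorm_ge0 ?(ltW r0).
  rewrite enorm_sqr; have := dot_ge0 (z - 2 *: p).
  rewrite !dotE (dotC p z) => h1 h2.
  have -> : (r / 2) ^+ 2 = r ^+ 2 / 4 by field.
  lra.
have p_gt0 : 0 < enorm p by apply: lt_le_trans rp; rewrite divr_gt0.
pose t := r / 2 / enorm p.
have t0 : 0 <= t by rewrite !divr_ge0 ?enorm_ge0 ?(ltW r0).
have t1 : t <= 1 by rewrite ler_pdivrMr// mul1r.
have normc : enorm (t *: p) = r / 2.
  apply/eqP; rewrite -(eqrXn2 (n := 2))// ?enorm_ge0 ?divr_ge0 ?(ltW r0)//.
  rewrite enorm_sqr !dotE -enorm_sqr /t.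
  by apply/eqP; field; rewrite gt_eqF.
exists (t *: p); split => // y etay; rewrite -normc enorm_le !dotE (dotC p y).
have := empty y etay; have := dot_ge0 y; nra.
Qed.

(** The set [A + a], so the motion is opposite to that of [translate a]. *)
Definition shift (a : vec R d) (A : set (vec R d)) : set (vec R d) :=
  [set y | A (y - a)].

Definition sep (s : R) (A B : set (vec R d)) : Prop :=
  forall a b, A a -> B b -> s <= enorm (a - b).

(** Indices run over [0 .. 2 M] and are recentred by [M]: a finite type thus enumerates the points
    of the lattice of step [l] with coordinates in [[- l M, l M]]. *)
Definition gridpt (l : R) (M : nat) (j : {ffun 'I_d -> 'I_(M.*2.+1)}) : vec R d :=
  \row_i (l * ((j i : nat)%:R - M%:R)).
Arguments gridpt : clear implicits.

Lemma gridpt_near (l : R) (M : nat) c : 0 < l ->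
  (forall i, `|c ord0 i| <= l * M%:R) ->
  exists j, forall i, 0 <= c ord0 i - gridpt l M j ord0 i <= l.
Proof.
move=> l0 cM.
(* Measured in steps and recentred, the coordinate lies in [[0, 2 M]], so its integer part is a
   valid index. *)
pose u i := c ord0 i / l + M%:R.
have u0 i : 0 <= u i.
  have := cM i; rewrite ler_norml => /andP[h _].
  by rewrite /u -lerBlDr sub0r ler_pdivlMr// mulrC mulrN.
have uM i : u i <= M%:R + M%:R.
  have := cM i; rewrite ler_norml => /andP[_ h].
  by rewrite /u lerD2r ler_pdivrMr// mulrC.
have lt i : (Num.truncn (u i) < M.*2.+1)%N.
  rewrite ltnS -(ler_nat R) -addnn natrD.
  by apply: le_trans (uM i); case/andP: (truncn_itv (u0 i)).
exists [ffun i => Ordinal (lt i)] => i; rewrite mxE ffunE/=.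
have /andP[h1 h2] := truncn_itv (u0 i).
have -> : c ord0 i - l * ((Num.truncn (u i))%:R - M%:R) =
   l * (u i - (Num.truncn (u i))%:R).
  by rewrite /u; field; rewrite gt_eqF.
move: h2; rewrite -natr1 => h2.
by apply/andP; split; nra.
Qed.

Lemma finite_bounded (xi A : set (vec R d)) : locally_finite xi ->
  bounded_vec A -> finite_set (xi `&` A).
Proof. by move=> lf [r Ar]; apply: sub_finite_set (lf r); apply: setIS. Qed.

Lemma bounded_Lam (r : R) : bounded_vec (Lam d r).
Proof. by exists r. Qed.

Lemma bounded_unit_cube : bounded_vec (unit_cube d : set (vec R d)).
Proof. by exists 1 => x xU i; rewrite ler_norml; have := xU i; lra. Qed.

Lemma bounded_shift a A : bounded_vec A -> bounded_vec (shift a A).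
Proof.
move=> [r Ar]; exists (r + enorm a) => x /Ar /= xr i.
rewrite -(subrK a x) mxE (le_trans (ler_normD _ _))// lerD ?normr_coord_le//.
Qed.

(* Constants: the empty ball has radius at least [8 * d * l], the box found
   below lies within [2 * d * l] of its centre, and cells have diameter at
   most [d]. *)
Lemma separated_empty_box (xi : set (vec R d)) x z (k : vec R d) (l0 l : R) :
  (0 < d)%N -> 1 <= l0 <= l -> xi x -> unit_cube d x ->
  dt_adj (translate x xi) z 0 -> 16 * d%:R * l <= enorm z ->
  shift k (unit_cube d) (z + x) ->
  exists j, let Q := shift (gridpt l (8 * d).+1 j) (Lam d l) in
    xi `&` Q = set0 /\ sep l0 (unit_cube d) Q /\ sep l0 (shift k (unit_cube d)) Q.
Proof.
move=> d0 /andP[l01 l0l] xix Ux adj hz Uz.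
have d1 : 1 <= d%:R :> R by rewrite ler1n.
have l_gt0 : 0 < l by apply: lt_le_trans l0l; apply: lt_le_trans l01.
have r0 : 0 < 16 * d%:R * l by rewrite !mulr_gt0// ltr0n.
have [c [normc empty]] := empty_ball adj r0 hz.
(* The centre [x + c] has coordinates of size at most [8 d l + 1 <= (8 d + 1) l], which fixes the
   size of the grid. *)
have [j hj] : exists j, forall i,
    0 <= (x + c) ord0 i - gridpt l (8 * d).+1 j ord0 i <= l.
  apply: gridpt_near => // i; rewrite mxE (le_trans (ler_normD _ _))//.
  have := normr_coord_le c i; rewrite normc.
  have : `|x ord0 i| <= 1 by rewrite ler_norml; have := Ux i; lra.
  by rewrite -[(8 * d).+1%:R]natr1 natrM; nra.
exists j => Q.
have Qc y : Q y -> enorm (y - (x + c)) <= d%:R * (2 * l).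
  move=> Qy; apply: enorm_le_coord; first by rewrite mulr_ge0// ltW.
  move=> i; have := Qy i; have := hj i.
  rewrite !mxE !ler_norml; lra.
have xi_far y : xi y -> 8 * d%:R * l <= enorm (y - (x + c)).
  move=> xiy; rewrite opprD addrA; apply: le_trans (empty _ _); last by exists y.
  by rewrite le_eqVlt; apply/orP; left; apply/eqP; field.
(* A point of [xi] in [A] is at distance at least [8 d l] from the centre; removing at most [d l]
   inside [A] and [2 d l] inside [Q] leaves more than [l >= l0]. *)
have farsep (A : set (vec R d)) y : xi y -> A y ->
    (forall a i, A a -> `|(y - a) ord0 i| <= 1) -> sep l0 A Q.
  move=> xiy Ay Adiam a b Aa Qb.
  have h1 : enorm (y - a) <= d%:R * 1 by apply: enorm_le_coord => // i; exact: Adiam.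
  have h2 := Qc _ Qb; have h3 := xi_far _ xiy.
  have h4 := enormD (y - a) (a - b); have h5 := enormD (y - b) (b - (x + c)).
  rewrite !addrA !subrK in h4 h5.
  have h6 : d%:R * 1 <= d%:R * l by rewrite ler_pM2l ?ltr0n//; apply: le_trans l0l.
  have h7 : l <= d%:R * l by rewrite ler_peMl// ltW.
  lra.
have diam (a b : vec R d) v i : shift v (unit_cube d) a -> shift v (unit_cube d) b ->
    `|(a - b) ord0 i| <= 1.
  by move=> /(_ i) + /(_ i); rewrite !mxE ler_norml; lra.
split; [|split].
- apply/seteqP; split => // y [/xi_far h1 /Qc h2].
  have : d%:R * (2 * l) < 8 * d%:R * l by nra.
  by move=> h3; have := le_lt_trans (le_trans h1 h2) h3; rewrite ltxx.
- apply: (farsep _ x) => // a i Ua.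
  by apply: (@diam _ _ 0); rewrite /shift /= subr0.
(* In the original coordinates the neighbour is [y = z + x], the point of [xi] that lies in the
   second cell. *)
- have [[y xiy yz] _] := adj.
  rewrite -yz subrK in Uz.
  apply: (farsep _ y) => // a i Ua; exact: (@diam _ _ k).
Qed.

End geometry.
Arguments gridpt {R d} l M j.

(** * Counting points in Borel sets *)

Section counting.
Context {R : realType} {d : nat}.
Implicit Types (x a : vec R d) (A B xi : set (vec R d)).

(** [fset_set] sends an infinite set to the empty one, so this is the number of points only when the
    intersection is finite. *)
Definition cnt xi A : nat := #|` fset_set (xi `&` A)|.

Lemma ncountE xi A : finite_set (xi `&` A) -> ncount xi A = (cnt xi A)%:R%:E.
Proof. by move=> fA; rewrite /ncount /counting asboolT. Qed.

Lemma counting_inj_image (T U : choiceType) (f : T -> U) (A : set T) :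
  injective f -> @counting U R (f @` A) = counting A.
Proof.
move=> finj; rewrite /counting.
have [fA|nfA] := pselect (finite_set A).
  rewrite !asboolT//; last exact: finite_image.
  by rewrite fset_set_image// card_imfset.
rewrite !asboolF// => fA; apply: nfA.
apply: sub_finite_set (finite_preimage _ fA); first by move=> x Ax; exists x.
by move=> x y _ _; exact: finj.
Qed.

Lemma ncount_translate x xi A : ncount (translate x xi) A = ncount xi (shift x A).
Proof.
rewrite /ncount -[RHS](@counting_inj_image _ _ (fun y : vec R d => y - x)).
  congr counting; apply/seteqP; split => y.
    by move=> [[z xiz <-] Az]; exists z.
  by move=> [z [xiz Az] <-]; split => //; exists z.
by move=> y z /addIr.
Qed.

Lemma borel_box (u v : 'I_d -> R) :
  borel_vec [set x : vec R d | forall i, u i <= x ord0 i <= v i].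
Proof.
rewrite -[X in borel_vec X]setCK; apply: (@sigma_algebraC (vec R d)).
apply: sub_sigma_algebra => /=; rewrite openC.
have -> : [set x : vec R d | forall i, u i <= x ord0 i <= v i] =
    \bigcap_(i in setT) ((fun x : vec R d => x ord0 i) @^-1` `[u i, v i]).
  apply/seteqP; split => x /= h i; first by move=> _ /=; rewrite in_itv/=.
  by have := h i I; rewrite /= in_itv.
apply: closed_bigI => i _; apply: closed_comp; last exact: interval_closed.
by move=> x _; exact: coord_continuous.
Qed.

Lemma borel_shift_Lam a (l : R) : borel_vec (shift a (Lam d l)).
Proof.
have -> : shift a (Lam d l) = [set x : vec R d |
    forall i, a ord0 i - l <= x ord0 i <= a ord0 i + l]; last exact: borel_box.
apply/seteqP; split => x /= h i; have := h i; rewrite !mxE ler_norml; lra.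
Qed.

Lemma borel_shift_unit_cube a : borel_vec (shift a (unit_cube d)).
Proof.
have -> : shift a (unit_cube d) = [set x : vec R d |
    forall i, a ord0 i <= x ord0 i <= a ord0 i + 1]; last exact: borel_box.
apply/seteqP; split => x /= h i; have := h i; rewrite !mxE; lra.
Qed.

Lemma shift0 A : shift 0 A = A.
Proof. by apply/seteqP; split => x; rewrite /shift /= subr0. Qed.

Lemma esum_cst xi A (c : \bar R) : finite_set (xi `&` A) -> (0 <= c)%E ->
  \esum_(x in xi `&` A) c = ((cnt xi A)%:R%:E * c)%E.
Proof.
move=> fA c0; rewrite esum_fset// fsbig_finite//= big_const_seq count_predT.
rewrite /cnt; elim: (size _) => [|n IH]/=; first by rewrite mul0e.
by rewrite IH -natr1 EFinD ge0_muleDl// ?mul1e ?lee_fin// addeC.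
Qed.

End counting.

(** * Second moments restricted to an event *)

Section second_moment.
Context {R : realType} {d0 : measure_display} {Omega : measurableType d0}.
Variable Pr : probability Omega R.

(** The first [n] odd numbers add up to [n ^ 2]; the cutoff is a factor, so that the series can be
    exchanged with an integral. *)
Lemma series_odd_lt (n : nat) :
  (\sum_(m <oo) ((m.*2.+1)%:R * (m < n)%N%:R : R)%:E)%E = (n%:R ^+ 2 : R)%:E.
Proof.
rewrite (nneseries_split 0 n)//= add0n.
rewrite [X in (_ + X)%E]eseries0 ?adde0; last first.
  by move=> i ni _; rewrite ltnNge ni mulr0.
rewrite sumEFin big_mkord; congr EFin.
transitivity (\sum_(m < n) (m.*2.+1)%:R : R).
  by apply: eq_bigr => i _; rewrite ltn_ord mulr1.
elim: n => [|n IH]; first by rewrite big_ord0 expr0n.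
by rewrite big_ord_recr/= IH -natr1 -muln2 natrM -natr1; ring.
Qed.

(** Reduces a second moment to tail events, on which independence and association act directly. *)
Lemma layer_cake_sqr (X : Omega -> nat) (E : set Omega) :
  (forall m, measurable [set w | (m < X w)%N]) -> measurable E ->
  (\int[Pr]_w ((X w)%:R ^+ 2 * \1_E w)%:E =
   \sum_(m <oo) (m.*2.+1)%:R%:E * Pr ([set w | (m < X w)%N] `&` E))%E.
Proof.
move=> mX mE.
have mXE m : measurable ([set w | (m < X w)%N] `&` E) by exact: measurableI.
transitivity (\int[Pr]_w \sum_(m <oo)
   ((m.*2.+1)%:R%:E * (\1_([set w | (m < X w)%N] `&` E) w)%:E))%E.
  apply: eq_integral => w _; rewrite EFinM -series_odd_lt muleC.
  rewrite -nneseriesZl//.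
  apply: eq_eseriesr => m _; rewrite -!EFinM; congr EFin.
  rewrite indicI mulrCA; congr (_ * _).
  by rewrite /= mulrC; congr (_ * _); rewrite indicE mem_setE.
rewrite integral_nneseries//; last first.
  by move=> m; apply: measurable_funeM; apply/measurable_EFinP.
apply: eq_eseriesr => m _; rewrite ge0_integralZl_EFin//.
- by rewrite integral_indic// setIT.
- by apply/measurable_EFinP.
Qed.

(** Product bounds for all tail events are summed term by term in the layer cake series. *)
Lemma second_moment_dominated (X : Omega -> nat) (E : set Omega) :
  (forall m, measurable [set w | (m < X w)%N]) -> measurable E ->
  (forall m, (Pr ([set w | (m < X w)%N] `&` E) <=
     Pr [set w | (m < X w)%N] * Pr E)%E) ->
  (\int[Pr]_w ((X w)%:R ^+ 2 * \1_E w)%:E <=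
   (\int[Pr]_w ((X w)%:R ^+ 2)%:E) * Pr E)%E.
Proof.
move=> mX mE h; rewrite layer_cake_sqr//.
have -> : (\int[Pr]_w ((X w)%:R ^+ 2)%:E = \int[Pr]_w ((X w)%:R ^+ 2 * \1_setT w)%:E)%E.
  by apply: eq_integral => w _; rewrite indicT mulr1.
have finE : Pr E \is a fin_num by exact: fin_num_measure.
rewrite layer_cake_sqr// muleC -(fineK finE) -nneseriesZl//; last first.
  by move=> m _; rewrite mule_ge0.
apply: lee_nneseries => m _; first by rewrite mule_ge0.
by rewrite setIT muleCA lee_wpmul2l// fineK// muleC.

Qed.

(* Splitting at the level [M] replaces Hoelder's inequality. *)
Lemma second_moment_truncated (X : Omega -> nat) (E : set Omega) (g M : R) :
  measurable_fun setT (fun w => (X w)%:R : R) -> measurable E ->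
  2 < g -> 0 < M ->
  (\int[Pr]_w ((X w)%:R ^+ 2 * \1_E w)%:E <=
   (M ^+ 2)%:E * Pr E + (M `^ (2 - g))%:E * \int[Pr]_w ((X w)%:R `^ g)%:E)%E.
Proof.
move=> mX mE g2 M0.
have mXg : measurable_fun setT (fun w => ((X w)%:R `^ g)%:E : \bar R).
  by apply/measurable_EFinP; exact: (measurableT_comp (measurable_powR g) mX).
have m1 : measurable_fun setT (fun w => (\1_E w)%:E : \bar R).
  by apply/measurable_EFinP.
apply: (@le_trans _ _ (\int[Pr]_w ((M ^+ 2)%:E * (\1_E w)%:E +
   (M `^ (2 - g))%:E * ((X w)%:R `^ g)%:E))%E).
  apply: ge0_le_integral => //.
  - apply/measurable_EFinP; apply: measurable_funM => //.
    exact: measurable_funX.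
  - by apply: emeasurable_funD; apply: measurable_funeM.
  - move=> w _; rewrite -!EFinM -EFinD lee_fin.
    have X0 : 0 <= (X w)%:R :> R by [].
    have I0 : 0 <= \1_E w :> R by rewrite indicE.
    have [XM|MX] := leP (X w)%:R M.
      rewrite -[leLHS]addr0 lerD ?mulr_ge0 ?powR_ge0// ler_wpM2r//.
      by rewrite ler_sqr ?nnegrE ?(ltW M0).
    rewrite -[leLHS]add0r lerD ?mulr_ge0 ?(ltW M0)//.
    have XX : 0 < (X w)%:R :> R by exact: lt_trans MX.
    apply: (@le_trans _ _ ((X w)%:R ^+ 2)).
      by rewrite ler_piMr ?sqr_ge0// indicE; case: (_ \in _).
    (* Above the level, [X ^ 2 = X ^ (2 - g) * X ^ g], and [X ^ (2 - g) <= M ^ (2 - g)] because the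
       exponent is negative. *)
    rewrite -powR_mulrn// -[in leLHS](subrK g 2%:R) powRD; last first.
      by rewrite (gt_eqF XX) implybT.
    rewrite ler_wpM2r ?powR_ge0//.
    rewrite -(opprB g) !powRN lef_pV2 ?posrE ?powR_gt0//.
    by rewrite ge0_ler_powR ?nnegrE ?(ltW M0) ?(ltW MX)// subr_ge0 ltW.
rewrite ge0_integralD//; last 4 first.
- by move=> w _; rewrite -EFinM lee_fin mulr_ge0 ?sqr_ge0.
- exact: measurable_funeM.
- by move=> w _; rewrite -EFinM lee_fin mulr_ge0 ?powR_ge0.
- exact: measurable_funeM.
rewrite !ge0_integralZl_EFin ?sqr_ge0 ?powR_ge0//.
by rewrite integral_indic// setIT.
Qed.

End second_moment.

(** * Measurability and stationarity of the counts *)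

Section process.
Context {R : realType} {d : nat} {d0 : measure_display}.
Context {Omega : measurableType d0}.
Variables (Pr : probability Omega R) (hat : Omega -> set (vec R d)).
Hypothesis lf : forall w, locally_finite (hat w).
Hypothesis mhat : forall A, borel_vec A ->
  measurable_fun setT (fun w => ncount (hat w) A).
Implicit Types (a b : vec R d) (A B Q : set (vec R d)).

Local Notation U := (unit_cube d : set (vec R d)).

Definition void A : set Omega := [set w | ncount (hat w) A = 0%E].

Lemma ncount_bounded w A : bounded_vec A ->
  ncount (hat w) A = (cnt (hat w) A)%:R%:E.
Proof. by move=> bA; apply/ncountE/finite_bounded. Qed.

Lemma measurable_ncount A (V : set (\bar R)) : borel_vec A -> measurable V ->
  measurable [set w | V (ncount (hat w) A)].
Proof.
by move=> bA mV; have := mhat bA measurableT mV; rewrite setTI.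
Qed.

Lemma measurable_void A : borel_vec A -> measurable (void A).
Proof. by move=> bA; exact: (measurable_ncount (V := [set 0%E])). Qed.

Lemma measurable_cnt A : borel_vec A -> bounded_vec A ->
  measurable_fun setT (fun w => (cnt (hat w) A)%:R : R).
Proof.
move=> bA bdA; have -> : (fun w => (cnt (hat w) A)%:R : R) =
    fine \o (fun w => ncount (hat w) A).
  by apply/funext => w /=; rewrite ncount_bounded.
by apply: measurableT_comp (mhat bA); exact: fine_measurable.
Qed.

(** Puts tail events in the form [V (ncount _ _)] used by measurability and by [sigma_restr]. *)
Lemma cnt_gtE A (m : nat) : bounded_vec A ->
  [set w | (m < cnt (hat w) A)%N] =
  [set w | `]m%:R%:E, +oo[%classic (ncount (hat w) A) ].
Proof.
move=> bA; apply/seteqP; split => w /=; rewrite ncount_bounded//.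
  by rewrite in_itv/= lte_fin ltr_nat andbT.
by rewrite in_itv/= lte_fin ltr_nat andbT.
Qed.

Lemma measurable_cnt_gt A (m : nat) : borel_vec A -> bounded_vec A ->
  measurable [set w | (m < cnt (hat w) A)%N].
Proof.
move=> bA bdA; rewrite cnt_gtE//.
exact: (measurable_ncount bA (emeasurable_itv _)).
Qed.

Lemma setI_void A (w : Omega) : hat w `&` A = set0 -> void A w.
Proof.
move=> h; rewrite /void /= ncountE; last by rewrite h; exact: finite_set0.
by rewrite /cnt h fset_set0 cardfs0.
Qed.

Lemma voidE w A : bounded_vec A -> void A w <-> hat w `&` A = set0.
Proof.
move=> bA; split; last exact: setI_void.
have fA : finite_set (hat w `&` A) by exact: finite_bounded.
rewrite /void /= ncount_bounded// => -[] /eqP.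
rewrite pnatr_eq0 /cnt cardfs_eq0 => /eqP h.
by rewrite -(fset_setK fA) h set_fset0.
Qed.

Section invariance.
Variable theta : vec R d -> Omega -> Omega.
Hypothesis PrTheta : forall (x : vec R d) (A : set Omega), measurable A ->
  Pr (theta x @` A) = Pr A.
Variable Os : set Omega.
Hypotheses (mOs : measurable Os) (OsT : forall x, theta x @` Os = Os).
Hypotheses (PrOs : Pr Os = 1%E).
Hypothesis hatT : forall w, Os w -> forall x, hat (theta x w) = translate x (hat w).

(** Covariance of [hat] is known on [Os] only. After intersecting with this invariant set of full
    measure, [theta a] maps the event for [shift a A] onto the event for [A]. *)
Lemma stationary a A (V : set (\bar R)) :
  borel_vec A -> borel_vec (shift a A) -> measurable V ->
  Pr [set w | V (ncount (hat w) (shift a A))] = Pr [set w | V (ncount (hat w) A)].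
Proof.
move=> bA baA mV.
have PrI (B : set Omega) : measurable B -> Pr (B `&` Os) = Pr B.
  move=> mB; have mBO : measurable (B `\` Os) by exact: measurableD.
  have PC : Pr (~` Os) = 0%E by rewrite probability_setC// PrOs subee.
  have P0 : Pr (B `\` Os) = 0%E.
    apply/eqP; rewrite eq_le measure_ge0 andbT -PC.
    by apply: le_measure; [exact/mem_set|exact/mem_set/measurableC|move=> w []].
  by have := measureDI Pr mB mOs; rewrite [X in (X + _)%E]P0 add0e => ->.
rewrite -[LHS]PrI; last exact: measurable_ncount.
rewrite -[RHS]PrI; last exact: measurable_ncount.
rewrite -(PrTheta a); last by apply: measurableI => //; exact: measurable_ncount.
congr (Pr _); apply/seteqP; split => w /=.
  move=> [v [Vv Osv] <-]; split; last by rewrite -(OsT a); exists v.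
  by rewrite hatT// ncount_translate.
move=> [Vw]; rewrite -{1}(OsT a) => -[v Osv vw].
exists v => //; split => //; move: Vw.
by rewrite -vw hatT// ncount_translate.
Qed.

End invariance.

Hypothesis stat : forall a A (V : set (\bar R)),
  borel_vec A -> borel_vec (shift a A) -> measurable V ->
  Pr [set w | V (ncount (hat w) (shift a A))] = Pr [set w | V (ncount (hat w) A)].

Lemma void_shift a A : borel_vec A -> borel_vec (shift a A) ->
  Pr (void (shift a A)) = Pr (void A).
Proof. by move=> bA baA; exact: (stat (V := [set 0%E])). Qed.

Let borelU : borel_vec U.
Proof. by rewrite -[X in borel_vec X]shift0; exact: borel_shift_unit_cube. Qed.

(** Both sides integrate one function against the law of a count, and these laws agree by
    stationarity; [fine] loses nothing, as counts in bounded sets are finite. *)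
Lemma moment_shift a (g : R) :
  (\int[Pr]_w ((cnt (hat w) (shift a U))%:R `^ g)%:E = rho Pr hat g)%E.
Proof.
pose f := fun y : \bar R => ((fine y) `^ g)%:E.
have mf : measurable_fun setT f.
  apply/measurable_EFinP; apply: (measurableT_comp (measurable_powR g)).
  exact: fine_measurable.
have bU := @bounded_unit_cube R d.
have baU := bounded_shift a bU.
have mN b : measurable_fun setT (fun w => ncount (hat w) (shift b U)).
  by apply: mhat; exact: borel_shift_unit_cube.
have E b : (\int[Pr]_w ((cnt (hat w) (shift b U))%:R `^ g)%:E =
    \int[pushforward Pr (fun w => ncount (hat w) (shift b U))]_y f y)%E.
  rewrite ge0_integral_pushforward//; last first.
    by move=> y _; rewrite lee_fin powR_ge0.
  rewrite preimage_setT; apply: eq_integral => w _.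
  by rewrite /f /= ncount_bounded//; exact: bounded_shift.
have -> : rho Pr hat g = (\int[Pr]_w ((cnt (hat w) (shift 0 U))%:R `^ g)%:E)%E.
  by apply: eq_integral => w _; rewrite shift0 ncount_bounded// poweR_EFin.
rewrite [LHS]E [RHS]E; apply: eq_measure_integral => V mV _.
have h b := stat borelU (borel_shift_unit_cube b) mV.
exact: (etrans (h a) (esym (h 0))).
Qed.

Lemma second_moment_shift a :
  (\int[Pr]_w ((cnt (hat w) (shift a U))%:R ^+ 2)%:E = rho Pr hat 2)%E.
Proof.
by rewrite -(moment_shift a); apply: eq_integral => w _; rewrite -powR_mulrn.
Qed.

End process.

(** * Second-moment decay under (H1) and (H3) *)

Lemma exprn_powR (R : realType) (x s : R) (n : nat) : 0 <= x ->
  (x ^+ n) `^ s = (x `^ s) ^+ n.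
Proof. by move=> x0; rewrite -!powR_mulrn ?powR_ge0// -!powRrM mulrC. Qed.

Section decay.
Context {R : realType} {d : nat} {d0 : measure_display}.
Context {Omega : measurableType d0}.
Variables (Pr : probability Omega R) (hat : Omega -> set (vec R d)).
Hypothesis lf : forall w, locally_finite (hat w).
Hypothesis mhat : forall A, borel_vec A ->
  measurable_fun setT (fun w => ncount (hat w) A).
Hypothesis stat : forall a A (V : set (\bar R)),
  borel_vec A -> borel_vec (shift a A) -> measurable V ->
  Pr [set w | V (ncount (hat w) (shift a A))] = Pr [set w | V (ncount (hat w) A)].
Implicit Types (a b : vec R d) (A B Q : set (vec R d)).

Local Notation U := (unit_cube d : set (vec R d)).
Local Notation above m A := [set w | (m < cnt (hat w) A)%N].

(** The interface between the hypotheses and the summation: each of (H1) to (H3) yields it with some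
    [q], uniformly in [a] and [b], and the summation asks for [q * 3 ^ (d + zeta) < 1]. *)
Definition moment_decay (l0 K q : R) : Prop := forall (n : nat) a b,
  let Q := shift b (Lam d (l0 * 3 ^+ n)) in
  sep l0 (shift a U) Q ->
  (\int[Pr]_w ((cnt (hat w) (shift a U))%:R ^+ 2 * \1_(void hat Q) w)%:E
     <= (K * q ^+ n)%:E)%E.

Lemma borel_Lam (l : R) : borel_vec (Lam d l).
Proof. by rewrite -[X in borel_vec X]shift0; exact: borel_shift_Lam. Qed.

Lemma Pr_void_shift_Lam b (l : R) :
  Pr (void hat (shift b (Lam d l))) = Pr (void hat (Lam d l)).
Proof. by apply: void_shift => //; [exact: borel_Lam|exact: borel_shift_Lam]. Qed.

Lemma sep_disjoint (s : R) A B : 0 < s -> sep s A B -> A `&` B = set0.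
Proof.
move=> s0 AB; apply/seteqP; split => // x [Ax Bx].
have := AB x x Ax Bx; rewrite subrr => /(lt_le_trans s0).
suff -> : enorm (0 : vec R d) = 0 by rewrite ltxx.
by rewrite /enorm big1 ?sqrtr0// => i _; rewrite mxE expr0n.
Qed.

(** Along the scales [3 ^ n] a power law becomes geometric; the factor [1] is the [l0] of
    [moment_decay]. *)
Lemma condC_triadic alpha : condC Pr hat alpha -> exists kappa : R, 0 <= kappa /\
  forall n, (Pr (void hat (Lam d (1 * 3 ^+ n))) <= (kappa * (3 `^ (- alpha)) ^+ n)%:E)%E.
Proof.
move=> [kappa [k0 h]]; exists kappa; split; first exact: ltW.
move=> n; rewrite mul1r; apply: le_trans (h _ _) _; first by rewrite exprn_ege1// ler1n.
by rewrite exprn_powR.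
Qed.

Lemma rho_fin g : (rho Pr hat g < +oo)%E -> rho Pr hat g = (fine (rho Pr hat g))%:E.
Proof.
move=> h; rewrite fineK// ge0_fin_numE//.
by apply: integral_ge0 => w _; exact: poweR_ge0.
Qed.

Lemma fine_rho_ge0 g : 0 <= fine (rho Pr hat g).
Proof.
by apply: fine_ge0; apply: integral_ge0 => w _; exact: poweR_ge0.
Qed.

Lemma moment_decay_hoelder (g alpha : R) : 2 < g -> (rho Pr hat g < +oo)%E ->
  condC Pr hat alpha ->
  exists K, 0 <= K /\ moment_decay 1 K (3 `^ (- (alpha * (g - 2) / g))).
Proof.
move=> g2 rg /condC_triadic[kappa [k0 hk]].
exists (kappa + fine (rho Pr hat g)); split; first by rewrite addr_ge0 ?fine_rho_ge0.
move=> n a b Q _; set q := 3 `^ _.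
have g0 : g != 0 by rewrite gt_eqF// (lt_trans _ g2).
(* The level [M ^ n] balances the two terms: [2 alpha / g - alpha] and [(2 - g) alpha / g] are the
   same exponent. *)
pose M : R := 3 `^ (alpha / g).
have M0 : 0 < M by rewrite powR_gt0.
have bdA := bounded_shift a (@bounded_unit_cube R d).
have baA := borel_shift_unit_cube a.
apply: le_trans (second_moment_truncated Pr (g := g) (M := M ^+ n) _ _ g2 _) _.
- exact: measurable_cnt.
- by apply: measurable_void => //; exact: borel_shift_Lam.
- by rewrite exprn_gt0.
rewrite moment_shift// rho_fin// Pr_void_shift_Lam mulrDl EFinD leeD//.
  apply: (@le_trans _ _ (((M ^+ n) ^+ 2)%:E * (kappa * (3 `^ (- alpha)) ^+ n)%:E)%E).
    by rewrite lee_wpmul2l// lee_fin sqr_ge0.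
  rewrite -EFinM lee_fin mulrCA ler_wpM2l// -exprM mulnC exprM -exprMn.
  rewrite lerXn2r ?nnegrE ?mulr_ge0 ?powR_ge0 ?exprn_ge0 ?(ltW M0)//.
  rewrite -powR_mulrn ?(ltW M0)// -powRrM -powRD ?pnatr_eq0 ?implybT//.
  by rewrite le_eqVlt; apply/orP; left; apply/eqP; congr (_ `^ _); field.
rewrite -EFinM lee_fin mulrC ler_wpM2l ?fine_rho_ge0// exprn_powR ?(ltW M0)//.
rewrite lerXn2r ?nnegrE ?powR_ge0// -powRrM.
by rewrite le_eqVlt; apply/orP; left; apply/eqP; congr (_ `^ _); field.
Qed.

Lemma rho2_lty g : 2 < g -> (rho Pr hat g < +oo)%E -> (rho Pr hat 2 < +oo)%E.
Proof.
move=> g2 rg; have bdU := bounded_shift 0 (@bounded_unit_cube R d).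
have mX := measurable_cnt lf mhat (borel_shift_unit_cube 0) bdU.
rewrite -(second_moment_shift lf mhat stat 0).
rewrite (eq_integral (fun w => ((cnt (hat w) (shift 0 U))%:R ^+ 2 * \1_setT w)%:E));
  last by move=> w _; rewrite indicT mulr1.
(* Truncation at level [1] on the whole space. *)
apply: le_lt_trans (second_moment_truncated Pr mX measurableT g2 ltr01) _.
by rewrite moment_shift// rho_fin// powR1 probability_setT -!EFinM -EFinD ltry.
Qed.

(** Common end of (H2) and (H3): once tail and void events decouple, the void probability factors
    out of the second moment. *)
Lemma moment_decay_decoupled (l0 kappa q : R) : (rho Pr hat 2 < +oo)%E ->
  0 <= kappa ->
  (forall n, (Pr (void hat (Lam d (l0 * 3 ^+ n))) <= (kappa * q ^+ n)%:E)%E) ->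
  (forall n a b (m : nat), let Q := shift b (Lam d (l0 * 3 ^+ n)) in
    sep l0 (shift a U) Q ->
    (Pr (above m (shift a U) `&` void hat Q) <=
       Pr (above m (shift a U)) * Pr (void hat Q))%E) ->
  exists K, 0 <= K /\ moment_decay l0 K q.
Proof.
move=> r2 k0 hk hdec; exists (fine (rho Pr hat 2) * kappa).
split; first by rewrite mulr_ge0 ?fine_rho_ge0.
move=> n a b Q sQ.
have bdA := bounded_shift a (@bounded_unit_cube R d).
have baA := borel_shift_unit_cube a.
apply: le_trans (second_moment_dominated _ _ (hdec n a b ^~ sQ)) _.
- by move=> m; exact: measurable_cnt_gt.
- by apply: measurable_void => //; exact: borel_shift_Lam.
rewrite second_moment_shift// rho_fin// Pr_void_shift_Lam -mulrA EFinM.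
by rewrite lee_wpmul2l// lee_fin fine_rho_ge0.
Qed.

(** A tail event is increasing in the count of one set and a void event decreasing in the count of
    the other, so positive association applies to one indicator and to minus the other. *)
Lemma pos_assoc_decoupled a b (l : R) (m : nat) : pos_assoc Pr hat ->
  let Q := shift b (Lam d l) in shift a U `&` Q = set0 ->
  (Pr (above m (shift a U) `&` void hat Q) <=
     Pr (above m (shift a U)) * Pr (void hat Q))%E.
Proof.
move=> pa Q disj; set E1 := above m (shift a U); set E2 := void hat Q.
have bdA := bounded_shift a (@bounded_unit_cube R d).
have baA := borel_shift_unit_cube a.
have bdQ : bounded_vec Q := bounded_shift b (bounded_Lam l).
have baQ : borel_vec Q := borel_shift_Lam b l.
have mE1 : measurable E1 by exact: measurable_cnt_gt.
have mE2 : measurable E2 by exact: measurable_void.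
have mE12 : measurable (E1 `&` E2) by exact: measurableI.
pose f (u : 'I_1 -> R) : R := if m%:R < u ord0 then 1 else 0.
pose g (u : 'I_1 -> R) : R := if u ord0 <= 0 then -1 else 0.
have fE : (fun w => f (fun=> fine (ncount (hat w) (shift a U)))) = \1_E1.
  apply/funext => w; rewrite /f ncount_bounded//= ltr_nat indicE.
  have -> : (w \in E1) = (m < cnt (hat w) (shift a U))%N.
    by apply/idP/idP => [/set_mem|/mem_set].
  by case: ifP.
have gE : (fun w => g (fun=> fine (ncount (hat w) Q))) = \- (\1_E2 : Omega -> R).
  apply/funext => w; rewrite /g ncount_bounded//= lern0 indicE.
  have -> : (w \in E2) = (cnt (hat w) Q == 0%N).
    apply/idP/idP => [/set_mem|/eqP h].
      by rewrite /E2 /void /= ncount_bounded// => -[] /eqP; rewrite pnatr_eq0.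
    by apply/mem_set; rewrite /E2 /void /= ncount_bounded// h.
  by case: ifP => _; rewrite ?oppr0.
have Lf (B : set Omega) : measurable B -> (\1_B : Omega -> R) \in Lfun Pr 1.
  by move=> mB; apply/Lfun1_integrable; exact: integrable_indic.
have I12 : (\1_E1 : Omega -> R) * \1_E2 = \1_(E1 `&` E2).
  by rewrite indicI.
have sqr1 (B : set Omega) w : (\1_B w : R) ^+ 2 = \1_B w.
  by rewrite indicE; case: (_ \in _); rewrite ?expr1n ?expr0n.
have cov : (0 <= covariance Pr (\1_E1) (\- (\1_E2 : Omega -> R)))%E.
  rewrite -fE -gE; apply: pa => //.
  - move=> u v uv; rewrite /f; case: ltP => mu; last by case: ifP.
    by rewrite (lt_le_trans mu)//; case/andP: (uv ord0).
  - move=> u v uv; rewrite /g; case: (leP (v ord0)) => v0.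
      by rewrite (le_trans _ v0)//; case/andP: (uv ord0).
    by case: ifP => // _; rewrite oppr_le0.
  - by move=> i j; rewrite !ord1.
  - by move=> i j; rewrite !ord1.
  - rewrite (_ : (fun w => _) = (fun w => (\1_E1 w)%:E)); first exact: integrable_indic.
    by apply/funext => w; rewrite -sqr1 -fE.
  - rewrite (_ : (fun w => _) = (fun w => (\1_E2 w)%:E)); first exact: integrable_indic.
    apply/funext => w; have /= -> := congr1 (@^~ w) gE.
    by rewrite sqrrN sqr1.
move: cov.
(* The covariance equals [Pr E1 * Pr E2 - Pr (E1 & E2)]. *)
rewrite covarianceNr ?I12 ?Lf// covarianceE ?I12 ?Lf// !expectation_indic//.
rewrite oppeB; last by rewrite fin_num_adde_defr// fin_num_measure.
by rewrite addeC sube_ge0// ?fin_numM ?fin_num_measure.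
Qed.

Lemma moment_decay_pos_assoc alpha : (rho Pr hat 2 < +oo)%E -> pos_assoc Pr hat ->
  condC Pr hat alpha -> exists K, 0 <= K /\ moment_decay 1 K (3 `^ (- alpha)).
Proof.
move=> r2 pa /condC_triadic[kappa [k0 hk]].
apply: (moment_decay_decoupled r2 k0 hk) => n a b m Q sQ.
by apply: pos_assoc_decoupled => //; exact: (sep_disjoint _ sQ).
Qed.

End decay.

(** * Second-moment decay under (H2) *)

Section finite_range_decay.
Context {R : realType} {d : nat} {d0 : measure_display}.
Context {Omega : measurableType d0}.
Variables (Pr : probability Omega R) (hat : Omega -> set (vec R d)).
Hypothesis lf : forall w, locally_finite (hat w).
Hypothesis mhat : forall A, borel_vec A ->
  measurable_fun setT (fun w => ncount (hat w) A).
Hypothesis stat : forall a A (V : set (\bar R)),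
  borel_vec A -> borel_vec (shift a A) -> measurable V ->
  Pr [set w | V (ncount (hat w) (shift a A))] = Pr [set w | V (ncount (hat w) A)].
Implicit Types (a b : vec R d) (A B Q : set (vec R d)).

Local Notation U := (unit_cube d : set (vec R d)).
Local Notation p l := (Pr (void hat (Lam d l))).

Lemma sigma_restr_ncount A (V : set (\bar R)) : borel_vec A -> measurable V ->
  sigma_restr hat A [set w | V (ncount (hat w) A)].
Proof.
move=> bA mV; apply: sub_sigma_algebra; exists A, V; split => //; split => //.
by apply/seteqP; split => w /=; rewrite /ncount -setIA setIid.
Qed.

Lemma sigma_restr_void A : borel_vec A -> sigma_restr hat A (void hat A).
Proof. by move=> bA; exact: (sigma_restr_ncount (V := [set 0%E])). Qed.

Lemma measurable_void_Lam (l : R) : measurable (void hat (Lam d l)).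
Proof. by apply: measurable_void => //; exact: borel_Lam. Qed.

Lemma void_anti A B : bounded_vec A -> bounded_vec B -> A `<=` B ->
  void hat B `<=` void hat A.
Proof.
move=> bA bB AB w; rewrite !voidE// => /seteqP[h _].
by apply/seteqP; split => // x [xw Ax]; apply: h; split => //; exact: AB.
Qed.

(** Continuity from above: the void events of growing cubes decrease to the null event of an empty
    configuration. *)
Lemma void_prob_cvg0 (q : R) : Pr [set w | hat w = set0] = 0%E -> 0 < q ->
  exists N : nat, forall l : R, N%:R <= l -> (p l <= q%:E)%E.
Proof.
move=> P0 q0; pose F (n : nat) := void hat (Lam d n%:R).
have capF : \bigcap_n F n = [set w | hat w = set0].
  apply/seteqP; split => w /=; last first.
    by move=> h n _; apply: setI_void; rewrite h set0I.
  move=> h; apply/seteqP; split => // x wx.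
  pose n := (Num.truncn (enorm x)).+1.
  have /(voidE lf w (bounded_Lam n%:R))/seteqP[+ _] := h n I.
  apply; split => // i; apply: le_trans (normr_coord_le x i) _.
  by apply/ltW/truncnS_gt.
have mF n : measurable (F n) by exact: measurable_void_Lam.
have niF : nonincreasing_seq F.
  move=> m n mn; apply/subsetPset/void_anti; [exact: bounded_Lam..|].
  by move=> x xm i; apply: le_trans (xm i) _; rewrite ler_nat.
have cvF : Pr \o F @ \oo --> 0%E.
  rewrite -P0 -capF; apply: nonincreasing_cvg_mu => //; last exact: bigcapT_measurable.
  by rewrite (le_lt_trans (probability_le1 Pr (mF 0%N)))// ltry.
have [N _ hN] : \forall n \near \oo, ((Pr \o F) n < q%:E)%E.
  apply: (cvF [set u | (u < q%:E)%E]).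
  by apply: open_ereal_lt'; rewrite lte_fin.
exists N => l Nl; apply: le_trans (ltW (hN N (leqnn N))).
apply: le_measure; [exact/mem_set/measurable_void_Lam|exact/mem_set/mF|].
apply: void_anti; [exact: bounded_Lam..|].
by move=> x xm i; exact: le_trans (xm i) _.
Qed.

(* Two opposite corners of a cube, each a third of its side, are at distance
   at least [2 * l] from each other. *)
Lemma void_prob_triple (L l : R) : (0 < d)%N -> L <= 2 * l -> 0 <= l ->
  (forall A B, borel_vec A -> borel_vec B ->
     (forall a b, A a -> B b -> L <= enorm (a - b)) ->
     forall E1 E2, sigma_restr hat A E1 -> sigma_restr hat B E2 ->
       Pr (E1 `&` E2) = (Pr E1 * Pr E2)%E) ->
  (p (3 * l) <= p l * p l)%E.
Proof.
move=> d_gt0 Ll l0 fr.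
pose a : vec R d := const_mx (2 * l).
(* All coordinates lie in [[l, 3 l]] on [A] and in [[- 3 l, - l]] on [B]; a single coordinate
   already separates them. *)
pose A := shift a (Lam d l); pose B := shift (- a) (Lam d l).
have bA : borel_vec A := borel_shift_Lam a l.
have bB : borel_vec B := borel_shift_Lam (- a) l.
rewrite -[X in (_ <= X * _)%E](Pr_void_shift_Lam stat a).
rewrite -[X in (_ <= _ * X)%E](Pr_void_shift_Lam stat (- a)).
have sAB x y : A x -> B y -> L <= enorm (x - y).
  move=> xA yB; pose i := Ordinal d_gt0.
  apply: le_trans Ll (le_trans _ (normr_coord_le (x - y) i)).
  apply: le_trans (ler_norm _).
  by have := xA i; have := yB i; rewrite !mxE !ler_norml; lra.
rewrite -(fr A B bA bB sAB _ _ (sigma_restr_void bA) (sigma_restr_void bB)).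
apply: le_measure; [exact/mem_set/measurable_void_Lam| |].
  by apply/mem_set/measurableI; exact: measurable_void.
have bd c : bounded_vec (shift c (Lam d l)) by exact/bounded_shift/bounded_Lam.
have corner (c : vec R d) : (forall i, `|c ord0 i| <= 2 * l) ->
    void hat (Lam d (3 * l)) `<=` void hat (shift c (Lam d l)).
  move=> cl; apply: void_anti; [exact: bd|exact: bounded_Lam|].
  move=> x xc i; have := xc i; have := cl i.
  by rewrite !mxE !ler_norml; lra.
by move=> w h; split; apply: corner h => i; rewrite !mxE ?normrN ger0_norm// mulr_ge0.
Qed.

Lemma finite_range_decoupled (L : R) A Q (m : nat) : borel_vec A -> bounded_vec A ->
  borel_vec Q -> sep L A Q ->
  (forall A B, borel_vec A -> borel_vec B ->
     (forall a b, A a -> B b -> L <= enorm (a - b)) ->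
     forall E1 E2, sigma_restr hat A E1 -> sigma_restr hat B E2 ->
       Pr (E1 `&` E2) = (Pr E1 * Pr E2)%E) ->
  Pr ([set w | (m < cnt (hat w) A)%N] `&` void hat Q) =
     (Pr [set w | (m < cnt (hat w) A)%N] * Pr (void hat Q))%E.
Proof.
move=> bA bdA bQ sQ fr; apply: (fr A Q) => //; last exact: sigma_restr_void.
by rewrite cnt_gtE//; apply: sigma_restr_ncount => //; exact: emeasurable_itv.
Qed.

(** The rate [q] is arbitrary: a large [l0] starts the recursion [p (3 l) <= p l ^ 2] below [q]. *)
Lemma moment_decay_finite_range (q : R) : (0 < d)%N -> 0 < q <= 1 ->
  (rho Pr hat 2 < +oo)%E -> finite_range Pr hat ->
  Pr [set w | hat w = set0] = 0%E ->
  exists l0 : nat, (0 < l0)%N /\ exists K, 0 <= K /\ moment_decay Pr hat l0%:R K q.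
Proof.
move=> d_gt0 /andP[q0 q1] r2 [L [L0 fr]] P0.
have [N hN] := void_prob_cvg0 P0 q0.
(* Beyond the range of dependence, and large enough for a void probability at most [q]. *)
pose l0 := (maxn (Num.truncn L).+1 N).
have Ll0 : L <= l0%:R.
  by apply: le_trans (ltW (truncnS_gt L)) _; rewrite ler_nat leq_maxl.
have l0_gt0 : 0 < l0%:R :> R by exact: lt_le_trans Ll0.
exists l0; split; first by rewrite -(ltr_nat R).
have hp n : (p (l0%:R * 3 ^+ n) <= (1 * q ^+ n)%:E)%E.
  (* The induction needs the extra factor [q]: squaring [q ^ (n + 1)] gives at most [q ^ (n + 2)],
     while squaring the bound [1] would gain nothing. *)
  suff : (p (l0%:R * 3 ^+ n) <= (q ^+ n.+1)%:E)%E.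
    move=> /le_trans; apply; rewrite lee_fin mul1r exprS ler_piMl// exprn_ge0//.
    exact: ltW.
  elim: n => [|n IH].
    by rewrite expr0 mulr1 expr1; apply: hN; rewrite ler_nat leq_maxr.
  have l3 : 1 <= 3 ^+ n :> R by rewrite exprn_ege1// ler1n.
  have ln0 : 0 <= l0%:R * 3 ^+ n :> R by rewrite mulr_ge0 ?exprn_ge0.
  have Lln : L <= 2 * (l0%:R * 3 ^+ n) by apply: le_trans Ll0 _; nra.
  rewrite exprS mulrCA; apply: le_trans (void_prob_triple d_gt0 Lln ln0 fr) _.
  apply: le_trans (lee_pmul _ _ IH IH) _ => //.
  rewrite -EFinM lee_fin [leRHS]exprS ler_wpM2r ?exprn_ge0 ?(ltW q0)//.
  by rewrite exprS ler_piMr ?exprn_ile1 ?(ltW q0).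
apply: (moment_decay_decoupled lf mhat stat r2 ler01 hp) => n a b m Q sQ.
rewrite (finite_range_decoupled (L := L))//.
- exact: borel_shift_unit_cube.
- exact/bounded_shift/bounded_unit_cube.
- exact: borel_shift_Lam.
- by move=> x y Ax By; apply: le_trans Ll0 _; exact: sQ.
Qed.

End finite_range_decay.

(** * Shells, cells and boxes: a pointwise bound on the neighbour moment *)

Section shells.
Context {R : realType} {d : nat} {d0 : measure_display}.
Context {Omega : measurableType d0}.
Variables (Pr : probability Omega R) (hat : Omega -> set (vec R d)).
Hypothesis d_gt0 : (0 < d)%N.
Hypothesis lf : forall w, locally_finite (hat w).
Hypothesis mhat : forall A, borel_vec A ->
  measurable_fun setT (fun w => ncount (hat w) A).
Variables (l0 : nat) (zeta : R).
Hypotheses (l0_gt0 : (0 < l0)%N) (zeta0 : 0 <= zeta).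
Implicit Types (a b x z : vec R d) (A Q : set (vec R d)).

Local Notation U := (unit_cube d : set (vec R d)).

(** The threshold of [separated_empty_box] at scale [l0 * 3 ^ n], kept in [nat] because it also
    sizes the grid of cells. *)
Definition radius (n : nat) : nat := (16 * d * (l0 * 3 ^ n))%N.

(** The number of boxes is the same for all shells. In [cell_index] the extra [1] allows for [x] in
    the unit cube, since the cells must cover [z + x]. *)
Definition box_index := {ffun 'I_d -> 'I_((8 * d).+1.*2.+1)}.
Definition cell_index n := {ffun 'I_d -> 'I_((radius n).+1.*2.+1)}.

Definition cell n (k : cell_index n) : set (vec R d) :=
  shift (gridpt 1 (radius n).+1 k) U.

Definition box n (j : box_index) : set (vec R d) :=
  shift (gridpt (l0%:R * 3 ^+ n) (8 * d).+1 j) (Lam d (l0%:R * 3 ^+ n)).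

(* Shell [n.+1] consists of the [z] with norm between [radius n] and
   [radius n.+1]; there is no empty box for the innermost shell. *)
Definition shell_void n (j : box_index) : set Omega :=
  if n is m.+1 then void hat (box m j) else setT.

Definition shell_sep n A (j : box_index) : Prop :=
  if n is m.+1 then sep l0%:R A (box m j) else True.

Lemma radiusE n : (radius n)%:R = 16 * d%:R * (l0%:R * 3 ^+ n) :> R.
Proof. by rewrite /radius !natrM natrX. Qed.

Lemma shell_of_neighbour w x z : hat w x -> U x ->
  dt_adj (translate x (hat w)) z 0 ->
  exists n (k : cell_index n) (j : box_index),
    [/\ enorm z <= (radius n)%:R, cell k (z + x), shell_sep n U j,
        shell_sep n (cell k) j & shell_void n j w].
Proof.
move=> wx Ux adj.
have exn : exists n, enorm z <= (radius n)%:R.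
  exists (Num.truncn (enorm z)).+1; apply: le_trans (ltW (truncnS_gt _)) _.
  rewrite ler_nat; apply: leq_trans (ltnW (ltn_expl _ (isT : (1 < 3)%N))) _.
  by rewrite /radius mulnA leq_pmull// !muln_gt0 d_gt0.
(* Minimality of [n] provides the lower bound on [|z|] when [n] is positive. *)
case: (ex_minnP exn) => n zn nmin.
have [k hk] : exists k : cell_index n, forall i,
    0 <= (z + x) ord0 i - gridpt 1 (radius n).+1 k ord0 i <= 1.
  apply: gridpt_near => // i; rewrite mxE mul1r -[X in _ <= X]natr1.
  rewrite (le_trans (ler_normD _ _))// lerD//.
    exact: le_trans (normr_coord_le z i) zn.
  by rewrite ler_norml; have := Ux i; lra.
have Cz : cell k (z + x) by move=> i; have := hk i; rewrite !mxE.
exists n, k; case: n => [|n] in zn nmin k hk Cz *; first by exists [ffun=> ord0].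
have zn' : (radius n)%:R <= enorm z.
  by rewrite leNgt; apply/negP => /ltW /nmin; rewrite ltnn.
have l3 : 1 <= 3 ^+ n :> R by rewrite exprn_ege1// ler1n.
have l01 : 1 <= (l0%:R : R) <= l0%:R * 3 ^+ n.
  by rewrite ler1n l0_gt0/= ler_peMr.
rewrite radiusE in zn'.
have [j [h1 [h2 h3]]] := separated_empty_box d_gt0 l01 wx Ux adj zn' Cz.
by exists j; split => //; exact: setI_void.
Qed.

(** Pairs that are not separated get weight zero, so [moment_decay] applies to every remaining term
    beyond the innermost shell. *)
Definition shell_weight n (k : cell_index n) (j : box_index) : R :=
  (radius n)%:R `^ zeta * `[< shell_sep n U j /\ shell_sep n (cell k) j >]%:R.

Lemma shell_weight_ge0 n (k : cell_index n) j : 0 <= shell_weight k j.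
Proof. by rewrite mulr_ge0 ?powR_ge0. Qed.

Lemma bounded_cell n (k : cell_index n) : bounded_vec (cell k).
Proof. exact/bounded_shift/bounded_unit_cube. Qed.

Lemma sum_indic_cell xi x n (k : cell_index n) (s : seq (vec R d)) :
  locally_finite xi -> uniq s -> (forall z, z \in s -> xi (z + x)) ->
  \sum_(z <- s) (z + x \in cell k)%:R <= (cnt xi (cell k))%:R :> R.
Proof.
move=> lxi us sxi; rewrite -natr_sum ler_nat.
pose t := [seq z + x | z <- s & z + x \in cell k].
have -> : (\sum_(z <- s) ((z + x)%R \in cell k) = size t)%N.
  rewrite size_map size_filter -sum1_count [RHS]big_mkcond/=.
  by apply: eq_bigr => z _; case: (_ \in _).
apply: uniq_leq_size; first by rewrite map_inj_uniq ?filter_uniq//; exact: addIr.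
move=> y /mapP[z]; rewrite mem_filter => /andP[/set_mem Cz zs] ->.
rewrite in_fset_set; last exact/finite_bounded/bounded_cell.
by apply/mem_set; split => //; exact: sxi.
Qed.

Definition shell_sum n (w : Omega) : R :=
  \sum_(k : cell_index n) \sum_(j : box_index)
    shell_weight k j * ((cnt (hat w) (cell k))%:R * \1_(shell_void n j) w).

(** Each neighbour is charged to a shell, a cell and a box, which makes the bound independent of
    [x]. *)
Lemma nbr_moment_le w x : hat w x -> U x ->
  (nbr_moment zeta (translate x (hat w)) <= \sum_(n <oo) (shell_sum n w)%:E)%E.
Proof.
move=> wx Ux; apply: ge_ereal_sup => /= _ [F [finF FN] <-].
rewrite fsbig_finite//=; set s := enum_fset _.
have us : uniq s := fset_uniq _.
have sN z : z \in s -> dt_adj (translate x (hat w)) z 0.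
  by rewrite in_fset_set// => /set_mem /FN.
have sxi z : z \in s -> hat w (z + x).
  by move=> /sN[[y wy <-] _]; rewrite subrK.
pose h n z : R := \sum_(k : cell_index n) \sum_(j : box_index)
    shell_weight k j * ((z + x \in cell k)%:R * \1_(shell_void n j) w).
have h0 n z : 0 <= h n z.
  apply: sumr_ge0 => k _; apply: sumr_ge0 => j _.
  by rewrite !mulr_ge0 ?shell_weight_ge0// indicE.
apply: (@le_trans _ _ (\sum_(z <- s) \sum_(n <oo) (h n z)%:E)%E).
  rewrite big_seq [leRHS]big_seq; apply: lee_sum => z zs.
  have [n [k [j [zn Cz s1 s2 vj]]]] := shell_of_neighbour wx Ux (sN z zs).
  (* The single term [(k, j)] of shell [n] already dominates [|z| ^ zeta]. *)
  apply: (@le_trans _ _ (h n z)%:E); last first.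
    apply: le_trans (nneseries_lim_ge n.+1 _); last by move=> m _ _; rewrite lee_fin.
    rewrite big_nat_recr//= leeDr//; apply: sume_ge0 => m _.
    by rewrite lee_fin.
  rewrite lee_fin /h (bigD1 k)//= (bigD1 j)//=.
  rewrite /shell_weight asboolT// mem_set// indicE mem_set// !mulr1 -addrA.
  rewrite -[leLHS]addr0 lerD//.
    by rewrite ge0_ler_powR ?nnegrE ?enorm_ge0.
  apply: addr_ge0; first apply: sumr_ge0 => j' _.
    by rewrite !mulr_ge0 ?shell_weight_ge0// indicE.
  apply: sumr_ge0 => k' _; apply: sumr_ge0 => j' _.
  by rewrite !mulr_ge0 ?shell_weight_ge0// indicE.
rewrite -nneseries_sum; last by move=> *; rewrite lee_fin.
apply: lee_nneseries => n _; first by rewrite sume_ge0// => *; rewrite lee_fin.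
(* Summing over [z] first turns the indicators of a cell into its number of points. *)
rewrite sumEFin lee_fin /h exchange_big; apply: ler_sum => k _.
rewrite exchange_big; apply: ler_sum => j _.
rewrite -mulr_sumr ler_wpM2l ?shell_weight_ge0// -mulr_suml.
by rewrite ler_wpM2r ?sum_indic_cell// indicE.
Qed.

End shells.
Arguments radius : clear implicits.
Arguments cell_index : clear implicits.
Arguments box_index : clear implicits.

(** The integral of a nonnegative function is a supremum over simple functions below it, hence
    monotone on arbitrary functions; this serves the Palm integrand, whose measurability is never
    established. *)
Lemma le_integral_nonmeasurable {d0 : measure_display} {T : measurableType d0}
    {R : realType} (mu : {measure set T -> \bar R}) (f g : T -> \bar R) :
  (forall x, 0 <= f x)%E -> (forall x, f x <= g x)%E ->
  (\int[mu]_x f x <= \int[mu]_x g x)%E.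
Proof.
move=> f0 fg; have g0 x : (0 <= g x)%E by exact: le_trans (fg x).
rewrite !ge0_integralTE//; apply: ereal_sup_le => _ [h hf <-].
exists h => // x; exact: le_trans (hf x) (fg x).
Qed.

Lemma nneseries_geometric_lty {R : realType} (C r : R) : 0 <= C -> 0 <= r < 1 ->
  (\sum_(n <oo) (C * r ^+ n)%:E < +oo)%E.
Proof.
move=> C0 /andP[r0 r1].
apply: (@le_lt_trans _ _ (C / (1 - r))%:E); last exact: ltry.
apply: lime_le.
  by apply: is_cvg_nneseries => n _ _; rewrite lee_fin mulr_ge0 ?exprn_ge0.
apply: nearW => n; rewrite sumEFin lee_fin -mulr_sumr ler_wpM2l//.
rewrite -div1r ler_pdivlMr ?subr_gt0// big_mkord mulrC.
have := subrX1 r n; have : 0 <= r ^+ n by rewrite exprn_ge0.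
lra.
Qed.

(** * Integration of the shell bound and summation over shells *)

Section shell_integrals.
Context {R : realType} {d : nat} {d0 : measure_display}.
Context {Omega : measurableType d0}.
Variables (Pr : probability Omega R) (hat : Omega -> set (vec R d)).
Hypothesis d_gt0 : (0 < d)%N.
Hypothesis lf : forall w, locally_finite (hat w).
Hypothesis mhat : forall A, borel_vec A ->
  measurable_fun setT (fun w => ncount (hat w) A).
Hypothesis stat : forall a A (V : set (\bar R)),
  borel_vec A -> borel_vec (shift a A) -> measurable V ->
  Pr [set w | V (ncount (hat w) (shift a A))] = Pr [set w | V (ncount (hat w) A)].
Variables (l0 : nat) (zeta K q : R).
Hypotheses (l0_gt0 : (0 < l0)%N) (zeta0 : 0 <= zeta) (K0 : 0 <= K) (q0 : 0 < q).
Hypothesis rho2 : (rho Pr hat 2 < +oo)%E.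
Hypothesis decay : moment_decay Pr hat l0%:R K q.
Implicit Types (a b x z : vec R d) (A Q : set (vec R d)).

Local Notation U := (unit_cube d : set (vec R d)).
Local Notation Shell_void := (shell_void hat l0).

Lemma measurable_shell_void n j : measurable (Shell_void n j).
Proof.
by case: n => [|n] //=; apply: measurable_void => //; exact: borel_shift_Lam.
Qed.

(** The term [rho] covers the innermost shell; [K / q] absorbs the index shift, as shell [n + 1]
    uses boxes of scale [n]. *)
Lemma cell_moment_le a n (j : box_index d) : shell_sep l0 n (shift a U) j ->
  (\int[Pr]_w ((cnt (hat w) (shift a U))%:R ^+ 2 * \1_(Shell_void n j) w)%:E
    <= ((fine (rho Pr hat 2) + K / q) * q ^+ n)%:E)%E.
Proof.
case: n => [_|n sQ] /=.
  under eq_integral do rewrite indicT mulr1.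
  rewrite second_moment_shift// rho_fin// lee_fin expr0 mulr1 lerDl.
  by rewrite divr_ge0// ltW.
apply: le_trans (decay sQ) _; rewrite lee_fin.
have -> : (fine (rho Pr hat 2) + K / q) * q ^+ n.+1 =
    fine (rho Pr hat 2) * q ^+ n.+1 + K * q ^+ n.
  by rewrite exprS; field; rewrite gt_eqF.
by rewrite lerDr mulr_ge0 ?fine_rho_ge0 ?exprn_ge0 ?(ltW q0).
Qed.

Lemma measurable_cnt_sqr_void a n j : measurable_fun setT (fun w =>
  ((cnt (hat w) (shift a U))%:R ^+ 2 * \1_(Shell_void n j) w)%:E : \bar R).
Proof.
apply/measurable_EFinP; apply: measurable_funM.
  apply: measurable_funX; apply: measurable_cnt => //; first exact: borel_shift_unit_cube.
  exact/bounded_shift/bounded_unit_cube.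
by apply: measurable_indic; exact: measurable_shell_void.
Qed.

Lemma shell_integral_le n :
  (\int[Pr]_w ((cnt (hat w) U)%:R * shell_sum hat l0 zeta n w)%:E <=
   ((#|cell_index d l0 n| * #|box_index d|)%:R * (radius d l0 n)%:R `^ zeta *
      (2 * (fine (rho Pr hat 2) + K / q) * q ^+ n))%:E)%E.
Proof.
set K' := fine _ + _.
have K'0 : 0 <= K' by rewrite addr_ge0 ?fine_rho_ge0 ?divr_ge0 ?(ltW q0).
pose X a (n : nat) (j : box_index d) w : R :=
  (cnt (hat w) (shift a U))%:R ^+ 2 * \1_(Shell_void n j) w.
have X0 a m j w : 0 <= X a m j w by rewrite mulr_ge0 ?sqr_ge0// indicE.
pose c (p : cell_index d l0 n * box_index d) : vec R d :=
  gridpt 1 (radius d l0 n).+1 p.1.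
pose F (p : cell_index d l0 n * box_index d) w : \bar R :=
  ((shell_weight zeta p.1 p.2)%:E * ((X 0 n p.2 w)%:E + (X (c p) n p.2 w)%:E))%E.
have mX a j : measurable_fun setT (fun w => (X a n j w)%:E).
  exact: measurable_cnt_sqr_void.
have mF p : measurable_fun setT (F p).
  by apply: measurable_funeM; apply: emeasurable_funD.
have F0 p w : (0 <= F p w)%E.
  by rewrite mule_ge0 ?lee_fin ?shell_weight_ge0// addr_ge0.
apply: (@le_trans _ _ (\int[Pr]_w \sum_p F p w)%E).
  apply: le_integral_nonmeasurable => w.
    rewrite lee_fin mulr_ge0//; apply: sumr_ge0 => k _; apply: sumr_ge0 => j _.
    by rewrite !mulr_ge0 ?shell_weight_ge0// indicE.
  rewrite /shell_sum pair_bigA mulr_sumr/= -sumEFin; apply: lee_sum => -[k j] _ /=.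
  rewrite /F /= -EFinD -EFinM lee_fin mulrCA ler_wpM2l ?shell_weight_ge0//.
  rewrite mulrA /X shift0 -mulrDl ler_wpM2r ?indicE//.
  (* The mixed product is split by [x y <= x ^ 2 + y ^ 2]. *)
  set x := (cnt _ U)%:R; set y := (cnt _ _)%:R.
  by have := sqr_ge0 (x - y); have := sqr_ge0 (x + y); nra.
rewrite ge0_integral_sum//.
apply: (@le_trans _ _ (\sum_(p : cell_index d l0 n * box_index d)
    ((radius d l0 n)%:R `^ zeta * (2 * K' * q ^+ n))%:E)%E); last first.
  rewrite sumEFin lee_fin sumr_const card_prod.
  rewrite -[leLHS]mulr_natl -[leRHS]mulrA.
  exact: lexx.
apply: lee_sum => -[k j] _; rewrite /F ge0_integralZl_EFin ?shell_weight_ge0//=; last 2 first.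
- by move=> w _; rewrite adde_ge0 ?lee_fin.
- exact: emeasurable_funD.
rewrite ge0_integralD//; [|by move=> w _; rewrite lee_fin..].
rewrite /shell_weight /=.
case: asboolP => [[sU sC]|_]; last first.
  by rewrite mulr0 mul0e lee_fin !mulr_ge0 ?powR_ge0 ?exprn_ge0 ?(ltW q0).
rewrite mulr1 EFinM lee_wpmul2l ?lee_fin ?powR_ge0//.
have -> : 2 * K' * q ^+ n = K' * q ^+ n + K' * q ^+ n by ring.
by rewrite EFinD leeD// cell_moment_le// shift0.
Qed.

Lemma shell_count_le n :
  ((#|cell_index d l0 n| * #|box_index d|)%:R * (radius d l0 n)%:R `^ zeta <=
   ((5 * radius d l0 0) ^ d * #|box_index d|)%:R * (radius d l0 0)%:R `^ zeta *
      (3 `^ (d%:R + zeta)) ^+ n :> R).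
Proof.
have radn : radius d l0 n = (radius d l0 0 * 3 ^ n)%N.
  by rewrite /radius expn0 muln1 mulnA.
have rad0 : (0 < radius d l0 n)%N by rewrite /radius !muln_gt0 d_gt0 l0_gt0 expn_gt0.
have -> : (3 `^ (d%:R + zeta)) ^+ n = ((3 ^ n) ^ d)%:R * (3 ^+ n) `^ zeta :> R.
  rewrite powRD ?pnatr_eq0 ?implybT// exprMn exprn_powR// powR_mulrn//.
  by rewrite !natrX exprAC.
rewrite mulrACA -natrM ler_pM ?powR_ge0//.
  rewrite mulnAC -expnMn -mulnA -radn ler_nat leq_mul2r; apply/orP; right.
  (* Per coordinate, [2 r + 3 <= 5 r] because the radius [r] is positive. *)
  rewrite card_ffun !card_ord leq_exp2r// -addnn; lia.
by rewrite radn natrM powRM ?ler0n// natrX.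
Qed.

Lemma shell_series_lty : q * 3 `^ (d%:R + zeta) < 1 ->
  (\sum_(n <oo) \int[Pr]_w ((cnt (hat w) U)%:R * shell_sum hat l0 zeta n w)%:E < +oo)%E.
Proof.
move=> qlt1; set K' := fine (rho Pr hat 2) + K / q.
have K'0 : 0 <= K' by rewrite addr_ge0 ?fine_rho_ge0 ?divr_ge0 ?(ltW q0).
pose C : R := ((5 * radius d l0 0) ^ d * #|box_index d|)%:R *
  (radius d l0 0)%:R `^ zeta.
have C0 : 0 <= C by rewrite mulr_ge0 ?powR_ge0.
have r1 : 0 <= q * 3 `^ (d%:R + zeta) < 1 by rewrite mulr_ge0 ?powR_ge0 ?(ltW q0).
apply: le_lt_trans (nneseries_geometric_lty (C := C * (2 * K')) _ r1); last first.
  by rewrite !mulr_ge0.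
apply: lee_nneseries => n _.
  move=> _; apply: integral_ge0 => w _; rewrite lee_fin mulr_ge0//.
  apply: sumr_ge0 => k _; apply: sumr_ge0 => j _.
  by rewrite !mulr_ge0 ?shell_weight_ge0// indicE.
apply: le_trans (shell_integral_le n) _; rewrite lee_fin.
have -> : C * (2 * K') * (q * 3 `^ (d%:R + zeta)) ^+ n =
    C * (3 `^ (d%:R + zeta)) ^+ n * (2 * K' * q ^+ n) by rewrite exprMn; ring.
by rewrite ler_wpM2r ?shell_count_le// !mulr_ge0 ?exprn_ge0 ?(ltW q0).
Qed.

Lemma palm_moment_lty : q * 3 `^ (d%:R + zeta) < 1 ->
  (palm_E Pr hat (nbr_moment zeta) < +oo)%E.
Proof.
move=> qlt1.
have ss0 n w : 0 <= shell_sum hat l0 zeta n w.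
  apply: sumr_ge0 => k _; apply: sumr_ge0 => j _.
  by rewrite !mulr_ge0 ?shell_weight_ge0// indicE.
have mss n : measurable_fun setT
    (fun w => ((cnt (hat w) U)%:R * shell_sum hat l0 zeta n w)%:E : \bar R).
  apply/measurable_EFinP/measurable_funM.
    apply: measurable_cnt => //; last exact: bounded_unit_cube.
    by rewrite -[X in borel_vec X]shift0; exact: borel_shift_unit_cube.
  apply: measurable_sum => k; apply: measurable_sum => j.
  apply: measurable_funM => //; apply: measurable_funM.
    apply: measurable_cnt => //; last exact: bounded_cell.
    exact: borel_shift_unit_cube.
  by apply: measurable_indic; exact: measurable_shell_void.
have nbr0 xi : (0 <= nbr_moment zeta xi :> \bar R)%E.
  by apply: esum_ge0 => z _; rewrite lee_fin powR_ge0.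
have int0 : (0 <= intensity Pr hat)%E.
  apply: integral_ge0 => w _; rewrite ncount_bounded//.
  exact: bounded_unit_cube.
rewrite /palm_E lte_mul_pinfty//; first by rewrite lee_fin invr_ge0 fine_ge0.
apply: le_lt_trans (shell_series_lty qlt1).
rewrite -integral_nneseries//; last first.
  by move=> n w _; rewrite lee_fin mulr_ge0.
apply: le_integral_nonmeasurable => w; first exact: esum_ge0.
under eq_eseriesr do rewrite EFinM.
rewrite nneseriesZl; last by move=> n _; rewrite lee_fin.
(* The count of [U] times a bound free of [x] is that bound summed over the points [x] of [U], ready
   for termwise comparison. *)
rewrite -esum_cst; last 2 first.
- exact/finite_bounded/bounded_unit_cube.
- by apply: nneseries_ge0 => n _ _; rewrite lee_fin.
by apply: le_esum => x [wx Ux]; exact: nbr_moment_le.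
Qed.

End shell_integrals.

(** * Choice of the rates and conclusion *)

Lemma powR_decay_lt1 {R : realType} (b s t : R) : 1 < b -> s < t ->
  b `^ (- t) * b `^ s < 1.
Proof.
move=> b1 st; rewrite -powRD; last by rewrite (gt_eqF (lt_trans ltr01 b1)) implybT.
rewrite /powR gt_eqF ?(lt_trans ltr01 b1)// -[ltRHS]expR0 ltr_expR.
by rewrite pmulr_llt0 ?ln_gt0// addrC subr_lt0.
Qed.

Theorem theorem4p8
  (R : realType) (d : nat) (d0 : measure_display) (Omega : measurableType d0)
  (Pr : probability Omega R)
  (theta : vec R d -> Omega -> Omega)
  (hat : Omega -> set (vec R d))
  (c : Omega -> vec R d -> vec R d -> R)
  (zeta : R) :
  (0 < d)%N ->
  (* measurable action of R^d on Omega *)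
  (forall w, theta 0 w = w) ->
  (forall x y w, theta (x + y) w = theta x (theta y w)) ->
  (forall B : set Omega, measurable B ->
     prod_sigma (@borel_vec R d) measurable [set p | B (theta p.1 p.2)]) ->
  (* hat is a simple point process: locally finite configurations, measurable *)
  (forall w, locally_finite (hat w)) ->
  (forall A, borel_vec A -> measurable_fun setT (fun w => ncount (hat w) A)) ->
  (* conductance field *)
  (forall U : set R, measurable U ->
     prod_sigma measurable (prod_sigma (@borel_vec R d) (@borel_vec R d))
       [set p | U (c p.1 p.2.1 p.2.2)]) ->
  (forall w x y, 0 <= c w x y) ->
  (forall w x y, c w x y = c w y x) ->
  (forall w x, c w x x = 0) ->
  (forall w x y, ~ dt_adj (hat w) x y -> c w x y = 0) ->
  (* (A1) *)
  (forall (x : vec R d) (A : set Omega), measurable A -> Pr (theta x @` A) = Pr A) ->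
  Pr [set w | hat w = set0] = 0%E ->
  (* (A2) *)
  (0 < intensity Pr hat < +oo)%E ->
  (* (A3) *)
  (exists Os : set Omega, measurable Os /\ (forall x, theta x @` Os = Os) /\
     Pr Os = 1%E /\
     forall w, Os w ->
       (forall x, hat (theta x w) = translate x (hat w)) /\
       (forall x y z, dt_adj (hat w) y z -> c (theta x w) (y - x) (z - x) = c w y z)) ->
  0 <= zeta ->
  (* (H1) or (H2) or (H3) *)
  ((exists gamma : R, 2 < gamma /\ (rho Pr hat gamma < +oo)%E /\
      exists alpha : R, gamma / (gamma - 2) * (d%:R + zeta) < alpha /\ condC Pr hat alpha)
   \/ ((rho Pr hat 2 < +oo)%E /\ finite_range Pr hat)
   \/ ((rho Pr hat 2 < +oo)%E /\ pos_assoc Pr hat /\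
       exists alpha : R, d%:R + zeta < alpha /\ condC Pr hat alpha)) ->
  (palm_E Pr hat (nbr_moment zeta) < +oo)%E.
Proof.
move=> d_gt0 _ _ _ lf mhat _ _ _ _ _ PrTheta P0 _ [Os [mOs [OsT [PrOs hOs]]]].
move=> zeta0 H.
have hatT w : Os w -> forall x, hat (theta x w) = translate x (hat w).
  by move=> /hOs[].
have stat := stationary mhat PrTheta mOs OsT PrOs hatT.
have three1 : 1 < 3 :> R by rewrite ltr1n.
case: H => [[g [g2 [rg [alpha [ag hC]]]]] | [[r2 fr] | [r2 [pa [alpha [ad hC]]]]]].
- have [K [K0 dec]] := moment_decay_hoelder lf mhat stat g2 rg hC.
  have q0 : 0 < 3 `^ (- (alpha * (g - 2) / g)) :> R by rewrite powR_gt0.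
  apply: (palm_moment_lty d_gt0 lf mhat stat (ltn0Sn 0) zeta0 K0 q0 _ dec).
    exact: (rho2_lty lf mhat stat g2 rg).
  (* The condition on [alpha] in (H1) says exactly that [d + zeta < alpha (g - 2) / g]. *)
  apply: powR_decay_lt1 => //; rewrite ltr_pdivlMr ?(lt_trans _ g2)//.
  by rewrite mulrC -ltr_pdivrMr ?subr_gt0// mulrAC.
(* Under (H2) the rate is free; one more power than [d + zeta] suffices. *)
- have q0 : 0 < 3 `^ (- (d%:R + zeta + 1)) :> R by rewrite powR_gt0.
  have q1 : 3 `^ (- (d%:R + zeta + 1)) <= 1 :> R.
    rewrite -[leRHS](powRr0 3) ler_powR ?(ltW three1)//.
    by rewrite oppr_le0 !addr_ge0.
  have q01 : 0 < (3 `^ (- (d%:R + zeta + 1)) : R) <= 1 by rewrite q0.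
  have [l0 [l0_gt0 [K [K0 dec]]]] :=
    moment_decay_finite_range lf mhat stat d_gt0 q01 r2 fr P0.
  apply: (palm_moment_lty d_gt0 lf mhat stat l0_gt0 zeta0 K0 q0 r2 dec).
  by apply: powR_decay_lt1 => //; rewrite ltrDl.
- have [K [K0 dec]] := moment_decay_pos_assoc lf mhat stat r2 pa hC.
  have q0 : 0 < 3 `^ (- alpha) :> R by rewrite powR_gt0.
  apply: (palm_moment_lty d_gt0 lf mhat stat (ltn0Sn 0) zeta0 K0 q0 r2 dec).
  exact: powR_decay_lt1.
Qed.
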